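(* Let $X$ be a nonzero finite-dimensional real vector space. For every finite convex $f:X\to\mathbb{R}$, put $\mathcal S_f:=\operatorname{ran}\partial f$, $\mathcal B_f:=\operatorname{dom} f^*$ and $\mathcal C_f:=\overline{\operatorname{dom} f^*}$ (subsets of $X^*$). Then $$\mathcal S_f\subseteq\mathcal B_f\subseteq\mathcal C_f,\qquad \overline{\mathcal B_f}=\mathcal C_f.$$ Moreover, the set $\mathcal C_f\setminus\mathcal B_f$ consists exactly of the normalized slopes $p=-b/a$ of objectives $\ell_{a,b}$ with $a>0$ that are copositive on $E_f^\infty$ but unbounded below on $E_f$; and the set $\mathcal B_f\setminus\mathcal S_f$ consists exactly of the normalized slopes $p=-b/a$ of objectives $\ell_{a,b}$ with $a>0$ whose infimum over $E_f$ is finite and not attained.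
   Context: $E_f=\{(t,z)\in\mathbb{R}\times X: t\ge f(z)\}$ and $\ell_{a,b}(t,z)=at+b(z)$ for $a\in\mathbb{R}$, $b\in X^*$. The Fenchel conjugate is $f^*(p)=\sup_{z\in X}\{p(z)-f(z)\}$, $\operatorname{dom} f^*=\{p\in X^*: f^*(p)<+\infty\}$; $\partial f(z)=\{p\in X^*: f(y)\ge f(z)+p(y-z)\ \forall y\in X\}$ and $\operatorname{ran}\partial f=\bigcup_{z\in X}\partial f(z)$. For a nonempty closed convex set $C$, $C^\infty=\{d: x+\lambda d\in C\ \forall x\in C,\ \forall\lambda\ge0\}$ is its recession cone; a linear functional $c$ is copositive on $C^\infty$ if $c(d)\ge0$ for all $d\in C^\infty$. A bar denotes closure. *)

(* Defs.v *)
From HB Require Import structures.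
From mathcomp Require Import all_boot all_order all_algebra.
From mathcomp Require Import all_classical all_reals all_analysis.

Set Implicit Arguments.
Unset Strict Implicit.
Unset Printing Implicit Defensive.

Import Order.TTheory GRing.Theory Num.Theory.
Import numFieldNormedType.Exports.

Local Open Scope classical_set_scope.
Local Open Scope ring_scope.

Section FiniteDimensionalClosure.
Context {R : realType}.

(* A vectType carries no topology of its own.  The closure is taken in the
   unique Hausdorff vector space topology, transported from R^n along the
   coordinates in a basis; the choice of basis is immaterial, since linear
   bijections of R^n are homeomorphisms. *)
Definition vclosure (V : vectType R) (B : set V) : set V :=
  closure (B : set (initial_topology (passmx.rVof (vbasis {:V})))).

End FiniteDimensionalClosure.

Section Cones.
Context {R : realType} {V : lmodType R}.

Definition recession_cone (C : set V) : set V :=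
  [set d | forall x, C x -> forall lambda : R, 0 <= lambda ->
     C (x + lambda *: d)].

Definition copositive (c : {linear V -> R^o}) (K : set V) : Prop :=
  forall d, K d -> 0 <= c d.

Definition unbounded_below_on (c : V -> R) (C : set V) : Prop :=
  ~ has_lbound (c @` C).

Definition inf_on (c : V -> R) (C : set V) : \bar R :=
  ereal_inf [set (c u)%:E | u in C].

Definition inf_attained_on (c : V -> R) (C : set V) : Prop :=
  exists2 u, C u & (c u)%:E = inf_on c C.

End Cones.

Section Objectives.
Context {R : realType} {X : vectType R}.

(* R^o is R seen as a module over itself, so that R^o * X is a vector space. *)
Definition ell (a : R) (b : 'Hom(X, R^o)) (tz : R^o * X) : R^o :=
  a * tz.1 + b tz.2.

Fact ell_is_linear a b : linear (ell a b).
Proof.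
move=> k [s y] [t z]; rewrite /ell /= linearP mulrDr.
by rewrite mulrCA -/(k *: (a * s : R^o)) addrACA -scalerDr.
Qed.

HB.instance Definition _ a b :=
  GRing.isLinear.Build R (R^o * X)%type R^o _ (ell a b) (ell_is_linear a b).

Definition normalized_slope (a : R) (b : 'Hom(X, R^o)) : 'Hom(X, R^o) :=
  - (a^-1 *: b).

End Objectives.

Section ConvexFunctions.
Context {R : realType} {X : vectType R}.
Implicit Type f : X -> R.

Definition epigraph f : set (R^o * X) := [set tz | f tz.2 <= tz.1].

Definition fenchel_conjugate f (p : 'Hom(X, R^o)) : \bar R :=
  ereal_sup [set (p z - f z)%:E | z in [set: X]].

Definition dom_conjugate f : set 'Hom(X, R^o) :=
  [set p | (fenchel_conjugate f p < +oo)%E].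

Definition subdifferential f (z : X) : set 'Hom(X, R^o) :=
  [set p | forall y, f y >= f z + p (y - z)].

Definition ran_subdifferential f : set 'Hom(X, R^o) :=
  \bigcup_z subdifferential f z.

End ConvexFunctions.

(* Main.v *)
Require Import Defs.
From HB Require Import structures.
From mathcomp Require Import all_boot all_order all_algebra.
From mathcomp Require Import all_classical all_reals all_analysis.
From mathcomp Require Import ring lra.
Import Order.TTheory GRing.Theory Num.Theory.
Import numFieldNormedType.Exports passmx.
Local Open Scope classical_set_scope.
Local Open Scope ring_scope.

(* The infimum of a t + b z over the epigraph is a times - f^*(p), p = - b / a;
   this turns boundedness and attainment into p being in dom f^* and in
   ran (subdifferential f).  The substantial point is that the closure of dom f^*
   consists of the p with p d <= s for all (s, d) in the recession cone of the
   epigraph.  If p is not in the closure, some d in X and e > 0 satisfy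
   q d <= p d - e for every q in dom f^*; the subgradient inequality for f at
   x + k d then shows that (p d - e, d) is a recession direction, on which
   (1, -p) is negative.
   Subgradients come from a finite-dimensional Hahn-Banach extension, and the
   separation is itself a subgradient, of the distance to dom f^*. *)

(** * Finite-dimensional Hahn-Banach extension and existence of subgradients *)

Section ConvexFunctionTheory.
Context {R : realType}.

Lemma convex_functionP (V : lmodType R) (f : V -> R) :
  convex_function [set: convex_lmodType V] f <->
  (forall (s t : R) (x y : V), 0 <= s -> 0 <= t -> s + t = 1 ->
     f (s *: x + t *: y) <= s * f x + t * f y).
Proof.
split=> [cvx s t x y s0 t0 st1|cvx t x y _ _]; last first.
  by apply: cvx; [exact: ge0|rewrite subr_ge0; exact: le1|rewrite addrC subrK].
have s01 : (0 <= s <= 1)%R by rewrite s0 -st1 lerDl.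
have -> : t = 1 - s by rewrite -st1 addrC addKr.
have /andP[_ s1] := s01.
have := cvx (Itv01 s0 s1) x y; rewrite !in_setT => /(_ isT isT).
by [].
Qed.

Context {X : vectType R}.

Lemma lfun_scale (p : 'Hom(X, R^o)) (a : R) (x : X) : p (a *: x) = a * p x :> R.
Proof. exact: linearZ. Qed.

Lemma lfun_add (p : 'Hom(X, R^o)) (x y : X) : p (x + y) = p x + p y :> R.
Proof. exact: linearD. Qed.

(** Here [c] is the value given to [v] when [phi] is extended to [W + <[v]>]. Convexity puts every
    backward slope along [v] below every forward one, and the supremum of the backward slopes lies
    in between. *)
Lemma hahn_banach_step (g : X -> R) (W : {vspace X}) (phi : 'Hom(X, R^o))
    (v : X) :
  convex_function [set: convex_lmodType X] g ->
  (forall w, w \in W -> phi w <= g w) ->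
  exists c : R, forall w (t : R), w \in W -> phi w + t * c <= g (w + t *: v).
Proof.
move=> /convex_functionP cvx le_phi.
have slopes w w' (s t : R) : w \in W -> w' \in W -> 0 < s -> 0 < t ->
    s^-1 * (phi w' - g (w' - s *: v)) <= t^-1 * (g (w + t *: v) - phi w).
  move=> wW w'W s0 t0; have st0 : 0 < s + t by rewrite addr_gt0.
  (* The weights are chosen so that [a * t = b * s]: the [v] components cancel and the convex
     combination falls back into [W]. *)
  pose a := s / (s + t); pose b := t / (s + t).
  have a0 : 0 <= a by rewrite divr_ge0 // ltW.
  have b0 : 0 <= b by rewrite divr_ge0 // ltW.
  have ab1 : a + b = 1 by rewrite /a /b -mulrDl divff ?gt_eqF.
  have /cvx := ab1 => /(_ (w + t *: v) (w' - s *: v) a0 b0).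
  have -> : a *: (w + t *: v) + b *: (w' - s *: v) = a *: w + b *: w'.
    rewrite !scalerDr scalerN !scalerA.
    have -> : a * t = b * s by rewrite /a /b; ring.
    by rewrite addrACA subrr addr0.
  move=> /(le_trans (le_phi _ (memvD (memvZ a wW) (memvZ b w'W)))).
  rewrite lfun_add !lfun_scale.
  move: (phi w : R) (phi w' : R) (g _) (g _) => fw fw' G' G le_ab.
  have {}le_ab : s * fw + t * fw' <= s * G + t * G'.
    have := ler_wpM2l (ltW st0) le_ab.
    have st : s + t != 0 by rewrite gt_eqF.
    have -> : (s + t) * (a * fw + b * fw') = s * fw + t * fw'.
      by rewrite /a /b; field.
    have -> : (s + t) * (a * G + b * G') = s * G + t * G'.
      by rewrite /a /b; field.
    by [].
  rewrite -(ler_pM2l t0) -(ler_pM2l s0).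
  have -> : s * (t * (s^-1 * (fw' - G'))) = t * (fw' - G').
    by field; rewrite gt_eqF.
  have -> : s * (t * (t^-1 * (G - fw))) = s * (G - fw).
    by field; rewrite gt_eqF.
  lra.
pose S := [set r | exists w s,
  [/\ w \in W, 0 < s & r = s^-1 * (phi w - g (w - s *: v))]].
have S0 : S !=set0.
  by exists (1^-1 * (phi 0 - g (0 - 1 *: v))), 0, 1; rewrite mem0v.
have ubS w t : w \in W -> 0 < t -> ubound S (t^-1 * (g (w + t *: v) - phi w)).
  by move=> wW t0 _ [w' [s [w'W s0 ->]]]; exact: slopes.
exists (sup S) => w t wW; case: (ltgtP t 0) => [t0|t0|->]; last first.
- by rewrite mul0r addr0 scale0r addr0 le_phi.
- have /(ge_sup S0) := ubS w t wW t0.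
  by rewrite ler_pdivlMl // lerBrDl.
- have Nt0 : 0 < - t by rewrite oppr_gt0.
  (* For negative [t] the inequality says that the backward slope with step [- t] is at most
     [sup S]; a forward slope from 0 shows that [S] is bounded above. *)
  have : (- t)^-1 * (phi w - g (w - (- t) *: v)) <= sup S.
    apply: ub_le_sup; last by exists w, (- t).
    by exists (1^-1 * (g (0 + 1 *: v) - phi 0)); apply: ubS; rewrite ?mem0v.
  rewrite ler_pdivrMl // scaleNr opprK mulNr.
  move: (phi w : R) (t * _) (g _) => a b c; lra.
Qed.

(** Induction on the span of the first [k] basis vectors: the zero functional works on the zero
    space because [0 <= g 0], and each new basis vector costs one extension step. *)
Lemma linear_minorant (g : X -> R) :
  convex_function [set: convex_lmodType X] g -> 0 <= g 0 ->
  exists phi : 'Hom(X, R^o), forall x, phi x <= g x.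
Proof.
move=> cvx g0; pose e := vbasis {:X}.
suff /(_ (\dim {:X}) (leqnn _))[phi le_phi] : forall k, (k <= \dim {:X})%N ->
    exists phi : 'Hom(X, R^o), forall x, x \in <<take k e>>%VS -> phi x <= g x.
  exists phi => x; apply: le_phi.
  by rewrite take_oversize ?size_tuple // (span_basis (vbasisP _)) memvf.
elim=> [_|k IH lt_k].
  exists 0 => x; rewrite take0 span_nil memv0 => /eqP ->.
  by rewrite lfunE.
have [phi le_phi] := IH (ltnW lt_k).
have [c le_c] := hahn_banach_step _ _ _ e`_k cvx le_phi.
pose psi : 'Hom(X, R^o) := linfun (coord e (Ordinal lt_k) : X -> R^o).
exists (phi + (c - phi e`_k) *: psi) => x.
have free_e : free e := basis_free (vbasisP _).
have sz_k : (k < size e)%N by rewrite size_tuple.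
rewrite (take_nth 0) // -cats1 span_cat span_seq1.
move=> /memv_addP[w wW [_ /vlineP[t ->] ->]].
have psi_w : psi w = 0.
  have sub_ker : (<<take k e>> <= lker psi)%VS.
    apply/span_subvP => u /(nthP 0)[i].
    rewrite size_take size_tuple lt_k => lt_ik; rewrite nth_take // => <-.
    rewrite memv_ker lfunE /=.
    have lt_i := ltn_trans lt_ik lt_k.
    rewrite (coord_free (Ordinal lt_i) (Ordinal lt_k) free_e) -val_eqE /=.
    by rewrite ltn_eqF.
  by apply/eqP; rewrite -memv_ker (subvP sub_ker).
have psi_e : psi e`_k = 1.
  by rewrite lfunE /= (coord_free (Ordinal lt_k) (Ordinal lt_k) free_e) eqxx.
rewrite lfunE /= lfunE /= !lfun_add !lfun_scale psi_w psi_e.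
apply: le_trans (le_c w t wW).
by rewrite add0r mulr1 [_ *: _]mulrC mulrBr addrA addrAC addrK.

Qed.

Lemma subdifferential_nonempty (f : X -> R) (z : X) :
  convex_function [set: convex_lmodType X] f -> subdifferential f z !=set0.
Proof.
move=> /convex_functionP cvx; pose g x := f (z + x) - f z.
have g_cvx : convex_function [set: convex_lmodType X] g.
  apply/convex_functionP => s t x y s0 t0 st1.
  have -> : g (s *: x + t *: y) = f (s *: (z + x) + t *: (z + y)) - f z.
    by rewrite !scalerDr addrACA -scalerDl st1 scale1r.
  have := cvx s t (z + x) (z + y) s0 t0 st1.
  rewrite /g !mulrBr addrACA -opprD -mulrDl st1 mul1r lerD2r.
  exact.
have [|phi le_phi] := linear_minorant g g_cvx; first by rewrite /g addr0 subrr.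
exists phi => y; have := le_phi (y - z).
by rewrite /g [z + _]addrC subrK lerBrDl.
Qed.

End ConvexFunctionTheory.

(** * Closure through a coordinate norm, separation and the bidual *)

Section ClosureSeparation.
Context {R : realType} {V : vectType R}.

(** The max norm of the coordinates, which induces the topology used by [vclosure]. *)
Definition coord_norm (v : V) : R := `|rVof (vbasis {:V}) v|.

Lemma coord_norm_ge0 (v : V) : 0 <= coord_norm v.
Proof. exact: normr_ge0. Qed.

Lemma coord_normD (u v : V) : coord_norm (u + v) <= coord_norm u + coord_norm v.
Proof. by rewrite /coord_norm linearD ler_normD. Qed.

Lemma coord_normZ (a : R) (v : V) : coord_norm (a *: v) = `|a| * coord_norm v.
Proof. by rewrite /coord_norm linearZ normrZ. Qed.

Lemma vclosureP (B : set V) (p : V) :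
  vclosure B p <->
  (forall e : R, 0 < e -> exists2 q, B q & coord_norm (p - q) < e).
Proof.
pose rV : V -> 'rV[R]_(\dim {:V}) := rVof (vbasis {:V}).
have ballE (q : initial_topology rV) e :
    ball (p : initial_topology rV) e q <-> coord_norm (p - q) < e.
  by rewrite -initial_ballE /= -ball_normE /ball_ /= /coord_norm linearB.
split=> [clB e e0|clB A].
  have [q [Bq /ballE ?]] := clB _ (nbhsx_ballx (p : initial_topology rV) e e0).
  by exists q.
move=> /(@nbhs_ballP R)[e /= e0 eA]; have [q Bq /ballE pq] := clB e e0.
by exists q; split=> //; exact: eA.
Qed.

Lemma lfun_coord_bound (h : 'Hom(V, R^o)) :
  exists2 M : R, 0 <= M & forall v, `|h v : R| <= M * coord_norm v.
Proof.
exists (\sum_(i < \dim {:V}) `|h (vbasis {:V})`_i : R|); first by rewrite sumr_ge0.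
move=> v; rewrite {1}(coord_vbasis (memvf v)) linear_sum mulr_suml.
apply: le_trans (ler_norm_sum _ _ _) _; apply: ler_sum => i _.
rewrite /= lfun_scale normrM mulrC ler_wpM2l //.
rewrite coord_rVof /coord_norm [leRHS]/Num.norm /= mx_normrE.
by apply/bigmax_geP; right; exists (ord0, i).
Qed.

Definition coord_dist (B : set V) (p : V) : R :=
  inf [set coord_norm (p - q) | q in B].

Lemma coord_dist_has_inf (B : set V) (p : V) :
  B !=set0 -> has_inf [set coord_norm (p - q) | q in B].
Proof.
move=> [b Bb]; split; first by exists (coord_norm (p - b)), b.
by exists 0 => _ [q _ <-]; exact: coord_norm_ge0.
Qed.

Lemma coord_dist_le (B : set V) (p q : V) :
  B q -> coord_dist B p <= coord_norm (p - q).
Proof.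
move=> Bq; apply: ge_inf; last by exists q.
by have [|] := coord_dist_has_inf B p; first by exists q.
Qed.

Lemma coord_dist_lt (B : set V) (p : V) (e : R) :
  B !=set0 -> 0 < e -> exists2 q, B q & coord_norm (p - q) < coord_dist B p + e.
Proof.
move=> B0 e0.
by have [_ [q Bq <-]] := inf_adherent e0 (coord_dist_has_inf B p B0); exists q.
Qed.

(** The infimum may not be attained, so points of [B] within [e] of the two distances are combined;
    their convex combination lies in [B]. *)
Lemma coord_dist_convex (B : set V) :
  B !=set0 -> convex_set (B : set (convex_lmodType V)) ->
  convex_function [set: convex_lmodType V] (coord_dist B).
Proof.
move=> B0 cvxB t x y _ _; apply/ler_addgt0Pr => e e0.
have [q Bq ltq] := coord_dist_lt B x e B0 e0.
have [r Br ltr] := coord_dist_lt B y e B0 e0.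
have t0 : 0 <= t%:num by exact: ge0.
have t'0 : 0 <= 1 - t%:num by rewrite subr_ge0; exact: le1.
have := cvxB q r t (mem_set Bq) (mem_set Br).
move=> /set_mem/(coord_dist_le _ (t%:num *: x + (1 - t%:num) *: y)).
move=> /le_trans; apply.
rewrite opprD addrACA -!scalerBr; apply: le_trans (coord_normD _ _) _.
rewrite !coord_normZ !ger0_norm //.
have := lerD (ler_wpM2l t0 (ltW ltq)) (ler_wpM2l t'0 (ltW ltr)).
move=> /le_trans; apply.
by rewrite !mulrDr addrACA -[_ * e + _]mulrDl subrKC mul1r.
Qed.

(* The separating functional is a subgradient at p of the distance to B. *)
Lemma vclosure_separation (B : set V) (p : V) :
  convex_set (B : set (convex_lmodType V)) -> ~ vclosure B p ->
  exists h : 'Hom(V, R^o), exists2 e : R, 0 < e &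
    forall q, B q -> h q + e <= h p.
Proof.
move=> cvxB notcl; have [B0|/nonemptyPn ->] := pselect (B !=set0); last first.
  by exists 0, 1.
have [h subh] := subdifferential_nonempty _ p (coord_dist_convex B B0 cvxB).
exists h, (coord_dist B p); last first.
  move=> q Bq; have := subh q; rewrite linearB /=.
  have := coord_dist_le B q q Bq; rewrite subrr /coord_norm linear0 normr0.
  move: (h p : R) (h q : R) => hp hq; lra.
rewrite ltNge; apply/negP => dist_le0; apply: notcl.
apply/vclosureP => e e0; have [q Bq ltq] := coord_dist_lt B p e B0 e0.
by exists q => //; apply: lt_le_trans ltq _; rewrite gerDr.
Qed.

Definition lfun_eval (d : V) (p : 'Hom(V, R^o)) : R^o := p d.

Fact lfun_eval_is_linear (d : V) : linear (lfun_eval d).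
Proof. by move=> c p q; rewrite /lfun_eval lfunE /= lfunE. Qed.

HB.instance Definition _ (d : V) :=
  GRing.isLinear.Build R 'Hom(V, R^o) R^o _ (lfun_eval d)
    (lfun_eval_is_linear d).

(** Expanding [p] in the dual basis [c] gives the vector with coordinates [h (c i)]. A functional
    separating slopes thereby becomes a direction in the space itself. *)
Lemma lfun_bidual (h : 'Hom('Hom(V, R^o), R^o)) :
  exists d : V, forall p, h p = p d.
Proof.
pose e := vbasis {:V}.
pose c i : 'Hom(V, R^o) := linfun (coord e i : V -> R^o).
exists (\sum_(i < \dim {:V}) h (c i) *: e`_i) => p.
have {1}-> : p = \sum_(i < \dim {:V}) p e`_i *: c i.
  apply/lfunP => v; rewrite sum_lfunE {1}(coord_vbasis (memvf v)) linear_sum.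
  by apply: eq_bigr => i _; rewrite !lfunE /= lfunE /= lfun_scale; exact: mulrC.
by rewrite !linear_sum; apply: eq_bigr => i _; rewrite /= !lfun_scale mulrC.
Qed.

End ClosureSeparation.

(** * Objectives over the epigraph in terms of the conjugate and subgradients *)

Section EpigraphObjectives.
Context {R : realType} {X : vectType R}.
Implicit Types (f : X -> R) (p b : 'Hom(X, R^o)) (a : R).

Lemma dom_conjugateP f p :
  dom_conjugate f p <-> exists M : R, forall z, p z - f z <= M.
Proof.
rewrite /dom_conjugate /fenchel_conjugate /=; split=> [|[M leM]]; last first.
  apply: le_lt_trans (ltry M); apply: ge_ereal_sup => _ [z _ <-].
  by rewrite lee_fin.
set s := ereal_sup _ => s_lt; exists (fine s) => z.
have le_s : ((p z - f z)%:E <= s)%E by apply: ereal_sup_ubound; exists z.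
by rewrite -lee_fin fineK // fin_real // s_lt (lt_le_trans _ le_s) ?ltNyr.
Qed.

Lemma dom_conjugate_convex f :
  convex_set (dom_conjugate f : set (convex_lmodType 'Hom(X, R^o))).
Proof.
move=> p q t /set_mem/dom_conjugateP[M leM] /set_mem/dom_conjugateP[N leN].
apply/mem_set/dom_conjugateP; exists (t%:num * M + (1 - t%:num) * N) => z.
have t0 : 0 <= t%:num by exact: ge0.
have t'0 : 0 <= 1 - t%:num by rewrite subr_ge0; exact: le1.
have := lerD (ler_wpM2l t0 (leM z)) (ler_wpM2l t'0 (leN z)).
apply: le_trans; rewrite !lfunE /= !lfunE /= !mulrBr addrACA -opprD -mulrDl.
by rewrite subrKC mul1r.
Qed.

Lemma ran_subdifferential_sub_dom f :
  ran_subdifferential f `<=` dom_conjugate f.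
Proof.
move=> p [z _ subp]; apply/dom_conjugateP; exists (p z - f z) => y.
have := subp y; rewrite linearB /=.
move: (p y : R) (p z : R) => py pz; lra.
Qed.

Lemma recession_epigraphP f (s : R^o) (d : X) :
  recession_cone (epigraph f) (s, d) <->
  (forall x (k : R), 0 <= k -> f (x + k *: d) <= f x + k * s).
Proof.
split=> [rec x k k0|rec [t x] /= ft k k0].
  by have := rec (f x, x) (lexx _) k k0.
by rewrite /epigraph /=; apply: le_trans (rec x k k0) _; rewrite lerD2r.
Qed.

(** A subgradient [q] at the far point [x + k *: d] gives [f (x + k *: d) <= f x + k * q d], and [q]
    lies in the domain of the conjugate, so [q d <= s]. *)
Lemma recession_epigraph_support f (s : R^o) (d : X) :
  convex_function [set: convex_lmodType X] f ->
  (forall q, dom_conjugate f q -> q d <= s) ->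
  recession_cone (epigraph f) (s, d).
Proof.
move=> cvx le_s; apply/recession_epigraphP => x k k0.
have [q subq] := subdifferential_nonempty f (x + k *: d) cvx.
have := subq x; rewrite opprD addrA subrr add0r -scaleNr lfun_scale mulNr.
have : k * q d <= k * s.
  apply: ler_wpM2l => //; apply: le_s; apply: ran_subdifferential_sub_dom.
  by exists (x + k *: d).
move: (q d : R) => qd; lra.
Qed.

Lemma vclosure_dom_conjugateP f p :
  convex_function [set: convex_lmodType X] f ->
  vclosure (dom_conjugate f) p <->
  (forall s d, recession_cone (epigraph f) (s, d) -> p d <= s :> R).
Proof.
move=> cvx; split=> [clp s d /recession_epigraphP rec|cop].
  apply/ler_addgt0Pr => e e0.
  (* Evaluation at [d] is Lipschitz in the slope, so a close enough [q] has [q d] within [e] of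
     [p d]. Dividing by [M + 1] allows for [M = 0]. *)
  have [M M0 leM] := lfun_coord_bound (linfun (lfun_eval d)).
  have e'0 : 0 < e / (M + 1) by rewrite divr_gt0 // ltr_wpDl.
  have [q /dom_conjugateP[N leN] ltq] := (vclosureP _ _).1 clp _ e'0.
  have qs : q d <= s.
    rewrite leNgt; apply/negP => s_lt.
    (* Along the ray from 0 in direction [d], [q - f] is at least [k * (q d - s) - f 0]; this [k]
       makes that exceed the bound [N]. *)
    pose k := (`|N + f 0| + 1) / (q d - s).
    have qds : 0 < (q d : R) - s by rewrite subr_gt0.
    have k0 : 0 < k by rewrite divr_gt0 // ltr_wpDl.
    have := rec 0 k (ltW k0); have := leN (0 + k *: d).
    rewrite add0r lfun_scale.
    have : k * (q d - s) = `|N + f 0| + 1 by rewrite mulfVK // gt_eqF.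
    rewrite mulrBr; have := ler_norm (N + f 0).
    move: (k * q d : R) (k * s) => A B; lra.
  have : `|p d - q d : R| <= e.
    have := leM (p - q); rewrite linearB /= !lfunE /lfun_eval => /le_trans; apply.
    apply: le_trans (ler_wpM2l M0 (ltW ltq)) _.
    rewrite mulrCA ger_pMr // ler_pdivrMr ?ltr_wpDl //.
    by rewrite mul1r lerDl.
  rewrite ler_norml => /andP[_].
  move: (p d : R) (q d : R) qs => pd qd; lra.
apply: contrapT => /(vclosure_separation _ _ (dom_conjugate_convex f)).
move=> [h [e e0 sep]]; have [d hE] := lfun_bidual h.
have /cop : recession_cone (epigraph f) (p d - e : R^o, d).
  apply: recession_epigraph_support => // q /sep; rewrite !hE.
  by rewrite lerBrDr.
by rewrite lerBrDr gerDl leNgt e0.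
Qed.

Lemma ell_normalized a b (t : R^o) (z : X) :
  0 < a -> ell a b (t, z) = a * (t - normalized_slope a b z).
Proof.
move=> a0; rewrite /ell /normalized_slope /= !lfunE /= lfunE /= opprK.
by rewrite mulrDr; congr (_ + _); rewrite [RHS]mulVKf ?gt_eqF.
Qed.

Lemma normalized_slope1N p : p = normalized_slope 1 (- p).
Proof. by rewrite /normalized_slope invr1 scale1r opprK. Qed.

Lemma copositive_ellP f a b :
  convex_function [set: convex_lmodType X] f -> 0 < a ->
  copositive (ell a b) (recession_cone (epigraph f)) <->
  vclosure (dom_conjugate f) (normalized_slope a b).
Proof.
move=> cvx a0; rewrite vclosure_dom_conjugateP //.
split=> [cop s d /cop|cop [s d] /cop].
  by rewrite /= ell_normalized // pmulr_rge0 // subr_ge0.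
by rewrite /= ell_normalized // pmulr_rge0 // subr_ge0.
Qed.

Lemma has_lbound_ellP f a b :
  0 < a ->
  has_lbound (ell a b @` epigraph f) <->
  dom_conjugate f (normalized_slope a b).
Proof.
move=> a0; rewrite dom_conjugateP; split=> [[m lbm]|[M leM]].
  exists (- (m / a)) => z; rewrite lerNr opprB ler_pdivrMr // mulrC.
  have /lbm : (ell a b @` epigraph f) (ell a b (f z, z)).
    by exists (f z, z) => //; exact: lexx.
  by rewrite ell_normalized.
exists (a * - M) => _ [[t z] /= ft <-].
rewrite ell_normalized // ler_pM2l // lerNl opprB.
by apply: le_trans (leM z); rewrite lerD2l lerN2.
Qed.

(** Nonemptiness excludes the value [+oo], so only [-oo] is left to rule out. *)
Lemma inf_on_fin_numP (V : lmodType R) (c : V -> R) (C : set V) :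
  C !=set0 -> inf_on c C \is a fin_num <-> has_lbound (c @` C).
Proof.
move=> [u Cu]; split=> [fin|[m lbm]].
  exists (fine (inf_on c C)) => _ [v Cv <-].
  by rewrite -lee_fin fineK //; apply: ereal_inf_lbound; exists v.
rewrite fin_real //; apply/andP; split.
  apply: lt_le_trans (ltNyr m) _; apply: le_ereal_inf_tmp => _ [v Cv <-].
  by rewrite lee_fin; apply: lbm; exists v.
by apply: le_lt_trans (ltry (c u)); apply: ereal_inf_lbound; exists u.
Qed.

Lemma inf_attained_onP (V : lmodType R) (c : V -> R) (C : set V) :
  inf_attained_on c C <-> exists2 u, C u & forall v, C v -> c u <= c v.
Proof.
split=> [[u Cu uE]|[u Cu le_u]]; exists u => //.
  by move=> v Cv; rewrite -lee_fin uE; apply: ereal_inf_lbound; exists v.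
apply/eqP; rewrite eq_le; apply/andP; split.
  by apply: le_ereal_inf_tmp => _ [v Cv <-]; rewrite lee_fin le_u.
by apply: ereal_inf_lbound; exists u.
Qed.

(** After division by [a], a minimizer [(t, z)] satisfies [f z - p z <= t - p z <= f y - p y] for
    all [y], with [p] the normalized slope: this is the subgradient inequality at [z]. Conversely, a
    subgradient at [z] makes the graph point [(f z, z)] a minimizer. *)
Lemma inf_attained_ellP f a b :
  0 < a ->
  inf_attained_on (ell a b) (epigraph f) <->
  ran_subdifferential f (normalized_slope a b).
Proof.
move=> a0; rewrite inf_attained_onP.
split=> [[[t z] /= ft le_u]|[z _ subp]].
  exists z => // y; have := le_u (f y, y) (lexx _).
  rewrite !ell_normalized // ler_pM2l // linearB /=.
  move: ft (normalized_slope a b y : R) (normalized_slope a b z : R).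
  rewrite /epigraph /= => ft py pz; lra.
exists (f z, z); first exact: lexx.
move=> [t y]; rewrite /epigraph /= => ft.
have := subp y; rewrite !ell_normalized // ler_pM2l // linearB /=.
move: (normalized_slope a b y : R) (normalized_slope a b z : R) => py pz; lra.
Qed.

End EpigraphObjectives.

Theorem corollary3p2 (R : realType) (X : vectType R)
    (X_nonzero : (0 < \dim {:X})%N)
    (f : X -> R) (f_convex : convex_function [set: convex_lmodType X] f) :
  let S_f : set 'Hom(X, R^o) := ran_subdifferential f in
  let B_f : set 'Hom(X, R^o) := dom_conjugate f in
  let C_f : set 'Hom(X, R^o) := vclosure (dom_conjugate f) in
  [/\ S_f `<=` B_f,
      B_f `<=` C_f,
      vclosure B_f = C_f,
      C_f `\` B_f =
        [set p | exists (a : R) (b : 'Hom(X, R^o)),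
           [/\ 0 < a,
               p = normalized_slope a b,
               copositive (ell a b) (recession_cone (epigraph f)) &
               unbounded_below_on (ell a b) (epigraph f)]]
    & B_f `\` S_f =
        [set p | exists (a : R) (b : 'Hom(X, R^o)),
           [/\ 0 < a,
               p = normalized_slope a b,
               inf_on (ell a b) (epigraph f) \is a fin_num &
               ~ inf_attained_on (ell a b) (epigraph f)]]].
Proof.
move=> S_f B_f C_f; split.
- exact: ran_subdifferential_sub_dom.
- exact: (@subset_closure (initial_topology (rVof (vbasis {:'Hom(X, R^o)})))).
- by [].
- apply/seteqP; split=> [p [Cp nBp]|p [a [b [a0 -> cop unb]]]].
    (* Every slope [p] is realized by the objective with [a = 1] and [b = - p]. *)
    exists 1, (- p); split=> //; first exact: normalized_slope1N.
      by apply/copositive_ellP; rewrite -?normalized_slope1N.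
    move=> /(has_lbound_ellP f _ _ ltr01).
    by rewrite -normalized_slope1N.
  split; first by apply/copositive_ellP.
  by move=> /(has_lbound_ellP f _ _ a0).
- have epi0 : epigraph f !=set0 by exists (f 0, 0); exact: lexx.
  apply/seteqP; split=> [p [Bp nSp]|p [a [b [a0 -> fin natt]]]].
    exists 1, (- p); split=> //; first exact: normalized_slope1N.
      apply/inf_on_fin_numP => //; apply/has_lbound_ellP => //.
      by rewrite -normalized_slope1N.
    move=> /(inf_attained_ellP f _ _ ltr01).
    by rewrite -normalized_slope1N.
  split; last by move=> /(inf_attained_ellP f _ _ a0).
  by apply/has_lbound_ellP => //; apply/inf_on_fin_numP.
Qed.
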